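(* Let $\mathcal{L}^{(M)}$ be an exactly solvable operator and $\mu$ a positive Borel measure. Then the bilinear form on polynomials $$[Q,P]=\int \mathcal{L}^{(M)}[Q](x)\,P(x)\,d\mu(x)$$ is an inner product if and only if both of the following hold: (1) $\mathcal{L}^{(M)}$ is a Bochner–Krall operator and $\mu$ is a measure with respect to which the polynomial eigenfunctions of the operator form a system of orthogonal polynomials; (2) $\mathcal{L}^{(M)}$ has positive eigenvalues. In such a case, the sequence of monic polynomials $\{Q_n\}_{n=0}^{\infty}$ orthogonal with respect to $(\mathcal{L}^{(M)},\mu)$ coincides with the sequence $\{P_n\}_{n=0}^{\infty}$ of monic orthogonal polynomials with respect to the measure $\mu$.
   Context: An exactly solvable operator of order $M$ is $\mathcal{L}^{(M)}=\sum_{k=0}^{M}\rho_k(x)\frac{d^k}{dx^k}$ acting on polynomials, where the $\rho_k$ are polynomials with $\deg\rho_k\le k$ for all $k$, with equality for at least one $k$, and $\rho_M\not\equiv 0$. The measure $\mu$ is a finite positive Borel measure on $\mathbb{R}$ all of whose moments are finite. The form $[\cdot,\cdot]$ is considered on the real vector space of real polynomials (inner product: real-valued, bilinear, symmetric, positive definite). A Bochner–Krall operator is a differential operator for which the associated sequence of eigenpolynomials (one of degree $n$ for each $n\ge 0$) is orthogonal with respect to some finite positive Borel measure on $\mathbb{R}$; ''eigenvalues'' are those associated with the eigenpolynomials. A nonzero polynomial $Q_n$ is orthogonal with respect to $(\mathcal{L}^{(M)},\mu)$ (for the index $n$) if $\deg Q_n\le n$ and $\int \mathcal{L}^{(M)}[Q_n](x)P(x)\,d\mu(x)=0$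 for every polynomial $P$ with $\deg P\le n-1$. *)

(* Defs.v *)
From HB Require Import structures.
From mathcomp Require Import all_boot all_order all_algebra.
From mathcomp Require Import all_classical all_reals all_analysis.

Set Implicit Arguments.
Unset Strict Implicit.
Unset Printing Implicit Defensive.

Import Order.TTheory GRing.Theory Num.Theory.
Import numFieldNormedType.Exports.

Local Open Scope classical_set_scope.
Local Open Scope ring_scope.

Definition diffop (R : realType) (M : nat) (rho : 'I_M.+1 -> {poly R})
    (Q : {poly R}) : {poly R} :=
  \sum_(k < M.+1) rho k * Q^`(k).

(* [size p] is [deg p + 1], and [0] for [p = 0]; hence a witness [k = 0] of the
   second clause means that [rho 0] is a nonzero constant. *)
Definition exactly_solvable (R : realType) (M : nat)
    (rho : 'I_M.+1 -> {poly R}) : Prop :=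
  [/\ forall k : 'I_M.+1, (size (rho k) <= k.+1)%N,
      exists k : 'I_M.+1, size (rho k) = k.+1
    & rho ord_max != 0].

Definition finite_moments (R : realType)
    (mu : {finite_measure set (measurableTypeR R) -> \bar R}) : Prop :=
  forall n : nat, mu.-integrable setT (fun x : R => (x ^+ n)%:E).

Definition diffop_form (R : realType) (M : nat) (rho : 'I_M.+1 -> {poly R})
    (mu : {finite_measure set (measurableTypeR R) -> \bar R})
    (Q P : {poly R}) : R :=
  \int[mu]_x ((diffop rho Q).[x] * P.[x]).

Definition inner_product (R : realType) (V : lmodType R) (B : V -> V -> R) :
    Prop :=
  [/\ forall v, scalar (B^~ v),
      forall u, scalar (B u),
      forall u v, B u v = B v u
    & forall u, u != 0 -> 0 < B u u].

(* As is usual for orthogonal polynomial systems, the squared norms must not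
   vanish; this excludes measures with finite support. *)
Definition orthogonal_polynomials (R : realType)
    (mu : {finite_measure set (measurableTypeR R) -> \bar R})
    (P : nat -> {poly R}) : Prop :=
  [/\ forall n, size (P n) = n.+1,
      forall m n, m != n -> \int[mu]_x ((P m).[x] * (P n).[x]) = 0
    & forall n, \int[mu]_x ((P n).[x] * (P n).[x]) != 0].

Definition monic_orthogonal_polynomials (R : realType)
    (mu : {finite_measure set (measurableTypeR R) -> \bar R})
    (P : nat -> {poly R}) : Prop :=
  orthogonal_polynomials mu P /\ forall n, P n \is monic.

Definition eigenpolynomial (R : realType) (M : nat)
    (rho : 'I_M.+1 -> {poly R}) (lambda : R) (p : {poly R}) : Prop :=
  p != 0 /\ diffop rho p = lambda *: p.

(* The sequence is quantified existentially because a multiple eigenvalue makes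
   the eigenpolynomial of degree [n] non-unique up to scaling: for a multiple of
   the identity every polynomial is an eigenpolynomial. *)
Definition orthogonal_eigenpolynomials (R : realType) (M : nat)
    (rho : 'I_M.+1 -> {poly R})
    (mu : {finite_measure set (measurableTypeR R) -> \bar R}) : Prop :=
  exists P : nat -> {poly R},
    (forall n, exists lambda, eigenpolynomial rho lambda (P n)) /\
    orthogonal_polynomials mu P.

Definition bochner_krall (R : realType) (M : nat)
    (rho : 'I_M.+1 -> {poly R}) : Prop :=
  exists nu : {finite_measure set (measurableTypeR R) -> \bar R},
    finite_moments nu /\ orthogonal_eigenpolynomials rho nu.

Definition positive_eigenvalues (R : realType) (M : nat)
    (rho : 'I_M.+1 -> {poly R}) : Prop :=
  forall lambda p, eigenpolynomial rho lambda p -> 0 < lambda.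

Definition diffop_orthogonal (R : realType) (M : nat)
    (rho : 'I_M.+1 -> {poly R})
    (mu : {finite_measure set (measurableTypeR R) -> \bar R})
    (n : nat) (Q : {poly R}) : Prop :=
  [/\ Q != 0, (size Q <= n.+1)%N
    & forall P : {poly R}, (size P <= n)%N -> diffop_form rho mu Q P = 0].

Definition monic_diffop_orthogonal_sequence (R : realType) (M : nat)
    (rho : 'I_M.+1 -> {poly R})
    (mu : {finite_measure set (measurableTypeR R) -> \bar R})
    (Q : nat -> {poly R}) : Prop :=
  forall n, Q n \is monic /\ diffop_orthogonal rho mu n (Q n).

(* Main.v *)
Require Import Defs.
From HB Require Import structures.
From mathcomp Require Import all_boot all_order all_algebra.
From mathcomp Require Import all_classical all_reals all_analysis.
From mathcomp Require Import lra.

Import Order.TTheory GRing.Theory Num.Theory.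
Import numFieldNormedType.Exports.

Local Open Scope classical_set_scope.
Local Open Scope ring_scope.

(** Write [<p, q>] for the integral of [p * q] against [mu] and [L] for the
    operator, so that the form of the theorem is [[Q, P] = <L Q, P>].  The
    operator never raises degrees, because [deg (rho k) <= k].

    If [[., .]] is an inner product, its symmetry says that [L] is self-adjoint
    for [<., .>].  Moreover [<., .>] is positive definite: by the Cauchy-Schwarz
    argument ([l2_form_isotropic]) a polynomial [q] with [<q, q> = 0] is
    orthogonal to everything, in particular to [L q], so that [[q, q] = 0].
    Hence [mu] has monic orthogonal polynomials [P n].  Self-adjointness moves
    [L] onto a test polynomial of degree less than [n], where it produces again
    a polynomial of degree less than [n]; so [L (P n)] is orthogonal to all of
    these, while its degree is at most [n], and it is therefore a multiple of
    [P n] ([selfadjoint_eigen]).  An eigenvalue [lambda] of an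
    eigenpolynomial [p] satisfies [[p, p] = lambda * <p, p>], so it is positive.

    Conversely, a basis of orthogonal eigenpolynomials with positive eigenvalues
    diagonalises [[., .]] with positive diagonal entries, and such a form is an
    inner product ([inner_product_of_orthogonal_basis]).

    For the last claim, the same [P n] is orthogonal to the lower degrees for
    both forms, since [[P n, q] = lambda * <P n, q>], and in an inner product
    space of polynomials a monic polynomial of degree at most [n] is determined
    by that orthogonality ([monic_orthogonal_unique]). *)

(** * Linear functionals and degrees *)

Lemma scalar_sub {R : nzRingType} {V : lmodType R} {f : V -> R} :
  scalar f -> forall u v, f (u - v) = f u - f v.
Proof. by move=> fl u v; rewrite addrC -scaleN1r fl mulN1r addrC. Qed.

Lemma scalar0 {R : nzRingType} {V : lmodType R} {f : V -> R} :
  scalar f -> f 0 = 0.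
Proof. by move=> fl; rewrite -(subrr 0) (scalar_sub fl) subrr. Qed.

Lemma scalarZ {R : nzRingType} {V : lmodType R} {f : V -> R} :
  scalar f -> forall a u, f (a *: u) = a * f u.
Proof. by move=> fl a u; rewrite -[a *: u]addr0 fl (scalar0 fl) addr0. Qed.

Lemma size_sub_leq {R : nzRingType} {n : nat} {p q : {poly R}} :
  (size p <= n.+1)%N -> (size q <= n.+1)%N -> p`_n = q`_n ->
  (size (p - q)%R <= n)%N.
Proof.
move=> sp sq pq; apply/leq_sizeP => j; rewrite leq_eqVlt coefB => /predU1P[<-|nj].
  by rewrite pq subrr.
by rewrite !nth_default ?subrr// (leq_trans _ nj).
Qed.

(** The induction step for statements about a basis with one polynomial [b] in
    each degree [n]. *)
Lemma poly_split_lead {R : fieldType} {n : nat} {b p : {poly R}} :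
  size b = n.+1 -> (size p <= n.+1)%N ->
  exists c (s : {poly R}), (size s <= n)%N /\ p = c *: b + s.
Proof.
move=> sb sp; have bn0 : b`_n != 0.
  by have := lead_coef_eq0 b; rewrite lead_coefE sb -size_poly_eq0 sb /= => ->.
exists (p`_n / b`_n), (p - (p`_n / b`_n) *: b); split; last by rewrite addrC subrK.
apply: size_sub_leq => //; first by rewrite (leq_trans (size_scale_leq _ _)) ?sb.
by rewrite coefZ divfK.
Qed.

Lemma size_diffop {R : realType} {M : nat} {rho : 'I_M.+1 -> {poly R}} :
  (forall k : 'I_M.+1, (size (rho k) <= k.+1)%N) ->
  forall p, (size (diffop rho p) <= size p)%N.
Proof.
move=> hrho p; apply: (leq_trans (size_sum _ _ _)); apply/bigmax_leqP => k _.
have [pk|kp] := leqP (size p) k; first by rewrite derivn_poly0// mulr0 size_poly0.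
have sD : (size p^`(k) <= size p - k)%N.
  by apply/leq_sizeP => j hj; rewrite coef_derivn nth_default ?mul0rn// -leq_subLR.
apply: (leq_trans (size_polyMleq _ _)).
have := leq_add (hrho k) sD; rewrite addSn subnKC; last exact: ltnW.
by case: (_ + _)%N.
Qed.

Lemma diffop_linear {R : realType} {M : nat} (rho : 'I_M.+1 -> {poly R}) :
  linear (diffop rho).
Proof.
move=> a p q; rewrite /diffop scaler_sumr -big_split; apply: eq_bigr => k _ /=.
by rewrite derivnD derivnZ mulrDr scalerAr.
Qed.

(** * Orthogonality to lower degrees *)

Definition orthogonal_below {R : realType} (B : {poly R} -> {poly R} -> R)
    (n : nat) (p : {poly R}) : Prop :=
  forall q : {poly R}, (size q <= n)%N -> B p q = 0.

Lemma orthogonal_below_eq0 {R : realType} {B : {poly R} -> {poly R} -> R} :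
  inner_product B -> forall n (p : {poly R}),
  (size p <= n)%N -> orthogonal_below B n p -> p = 0.
Proof.
move=> [_ _ _ Bpos] n p sp pn; apply: contrapT => /eqP /Bpos.
by rewrite pn// ltxx.
Qed.

(** Only [deg p <= n] is assumed: a monic [p] of degree less than [n] would be
    orthogonal to itself. *)
Lemma monic_orthogonal_size {R : realType} {B : {poly R} -> {poly R} -> R} :
  inner_product B -> forall n (p : {poly R}), p \is monic ->
  (size p <= n.+1)%N -> orthogonal_below B n p -> size p = n.+1.
Proof.
move=> ipB n p pm sp pn; apply/eqP; rewrite eqn_leq sp ltnNge; apply/negP => sp'.
by move: (monic_neq0 pm); rewrite (orthogonal_below_eq0 ipB _ _ sp' pn) eqxx.
Qed.

Lemma monic_orthogonal_unique {R : realType} {B : {poly R} -> {poly R} -> R} :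
  inner_product B -> forall n (p q : {poly R}),
  p \is monic -> (size p <= n.+1)%N -> orthogonal_below B n p ->
  q \is monic -> (size q <= n.+1)%N -> orthogonal_below B n q -> p = q.
Proof.
move=> ipB n p q pm sp pn qm sq qn.
have [Bl _ _ _] := ipB.
have sp1 := monic_orthogonal_size ipB _ _ pm sp pn.
have sq1 := monic_orthogonal_size ipB _ _ qm sq qn.
apply/subr0_eq/(orthogonal_below_eq0 ipB n).
  apply: size_sub_leq => //.
  by move/monicP: pm; move/monicP: qm; rewrite !lead_coefE sp1 sq1 /= => -> ->.
by move=> r sr; rewrite (scalar_sub (Bl r)) pn// qn// subrr.
Qed.

(** The Gram-Schmidt process: the projection onto degree at most [n] is that onto
    degree less than [n] corrected along [e], the [n]-th monic orthogonal
    polynomial, which is what projecting ['X^n] leaves. *)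
Lemma orthogonal_projection {R : realType} {B : {poly R} -> {poly R} -> R} :
  inner_product B -> forall n (p : {poly R}),
  exists q : {poly R}, (size q <= n)%N /\ orthogonal_below B n (p - q).
Proof.
move=> [Bl Br Bsym Bpos]; elim=> [|n IH] p.
  exists 0; rewrite size_poly0; split=> // r.
  by rewrite leqn0 size_poly_eq0 => /eqP ->; rewrite (scalar0 (Br _)).
have [q0 [sq0 q0n]] := IH 'X^n.
have [q1 [sq1 q1n]] := IH p.
set e := 'X^n - q0 in q0n.
have se : size e = n.+1.
  by rewrite size_polyDl size_polyXn// size_polyN ltnS.
have Bee : B e e != 0 by rewrite gt_eqF// Bpos// -size_poly_eq0 se.
set c := B (p - q1) e / B e e.
exists (q1 + c *: e); split.
  rewrite (leq_trans (size_polyD _ _))// geq_max (leq_trans sq1)//=.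
  by rewrite (leq_trans (size_scale_leq _ _)) ?se.
move=> r sr; have [a [s [ss ->]]] := poly_split_lead se sr.
rewrite opprD addrA (scalar_sub (Bl _)) (scalarZ (Bl _)) !Br.
by rewrite (q1n s)// (q0n s)// !addr0 /c mulrCA divfK// subrr.
Qed.

Lemma monic_orthogonal_exists {R : realType} {B : {poly R} -> {poly R} -> R} :
  inner_product B -> exists P : nat -> {poly R}, forall n,
  [/\ P n \is monic, size (P n) = n.+1 & orthogonal_below B n (P n)].
Proof.
move=> ipB; have /choice[q qP] := fun n => orthogonal_projection ipB n 'X^n.
exists (fun n => 'X^n - q n) => n; have [sq qn] := qP n.
have sX : (size (- q n) < size ('X^n : {poly R}))%N.
  by rewrite size_polyN size_polyXn ltnS.
split=> //; last by rewrite size_polyDl// size_polyXn.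
by rewrite monicE lead_coefDl// lead_coefXn.
Qed.

Lemma orthogonal_basis_below {R : realType} {B : {poly R} -> {poly R} -> R}
    {P : nat -> {poly R}} :
  (forall u, scalar (B u)) -> (forall n, size (P n) = n.+1) ->
  (forall m n, m != n -> B (P m) (P n) = 0) ->
  forall n, orthogonal_below B n (P n).
Proof.
move=> Br sP oP n.
suff H k : (k <= n)%N -> orthogonal_below B k (P n) by exact: H.
elim: k => [|k IH] kn q sq.
  by move: sq; rewrite leqn0 size_poly_eq0 => /eqP ->; rewrite (scalar0 (Br _)).
have [c [s [ss ->]]] := poly_split_lead (sP k) sq.
by rewrite Br oP ?gtn_eqF// mulr0 add0r (IH (ltnW kn)).
Qed.

(** In the basis [P] the form is diagonal with positive entries.  Peeling off the
    leading term keeps the argument free of expansions into sums. *)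
Lemma inner_product_of_orthogonal_basis {R : realType}
    {B : {poly R} -> {poly R} -> R} {P : nat -> {poly R}} :
  (forall v, scalar (B^~ v)) -> (forall u, scalar (B u)) ->
  (forall n, size (P n) = n.+1) ->
  (forall m n, m != n -> B (P m) (P n) = 0) ->
  (forall n, 0 < B (P n) (P n)) ->
  inner_product B.
Proof.
move=> Bl Br sP oP posP.
have lo := orthogonal_basis_below Br sP oP.
have ro : forall n, orthogonal_below (fun p q => B q p) n (P n).
  apply: orthogonal_basis_below => // m n mn.
  by apply: oP; rewrite eq_sym.
have expand n c d (s t : {poly R}) : (size s <= n)%N -> (size t <= n)%N ->
    B (c *: P n + s) (d *: P n + t) = c * d * B (P n) (P n) + B s t.
  move=> ss st; rewrite Bl !Br (lo n t)// (ro n s ss : B s (P n) = 0).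
  by rewrite mulr0 addr0 add0r mulrA.
split=> // [p q|].
  have : exists n, (size p <= n)%N /\ (size q <= n)%N.
    by exists (maxn (size p) (size q)); rewrite leq_maxl leq_maxr.
  case=> n; elim: n p q => [|n IH] p q [sp sq].
    move: sp sq; rewrite !leqn0 !size_poly_eq0 => /eqP -> /eqP ->.
    by rewrite (scalar0 (Br _)).
  have [c [s [ss ->]]] := poly_split_lead (sP n) sp.
  have [d [t [st ->]]] := poly_split_lead (sP n) sq.
  by rewrite !expand// (IH s t)// [c * d]mulrC.
have nonneg n (p : {poly R}) : (size p <= n)%N -> 0 <= B p p.
  elim: n p => [|n IH] p sp.
    by move: sp; rewrite leqn0 size_poly_eq0 => /eqP ->; rewrite (scalar0 (Br _)).
  have [c [s [ss ->]]] := poly_split_lead (sP n) sp.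
  by rewrite expand// addr_ge0 ?IH// mulr_ge0 ?sqr_ge0// ltW.
move=> p p0; have := p0; rewrite -size_poly_gt0.
case E : (size p) => [//|n] _.
have [||c [s [ss pE]]] := @poly_split_lead _ n (P n) p; rewrite ?sP ?E//.
have c0 : c != 0.
  apply/eqP => c0; move: E; rewrite pE c0 scale0r add0r => E.
  by rewrite E ltnn in ss.
rewrite pE expand// ltr_wpDr//; first exact: nonneg ss.
by rewrite mulr_gt0// lt0r mulf_neq0//= sqr_ge0.
Qed.

(** The degree bound on [L] and self-adjointness force [L] to be triangular from
    both sides in an orthogonal basis, hence diagonal. *)
Lemma selfadjoint_eigen {R : realType} {B : {poly R} -> {poly R} -> R}
    {L : {poly R} -> {poly R}} :
  inner_product B -> (forall p : {poly R}, (size (L p) <= size p)%N) ->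
  (forall p q, B (L p) q = B p (L q)) ->
  forall n (p : {poly R}), size p = n.+1 -> orthogonal_below B n p ->
  exists lambda, L p = lambda *: p.
Proof.
move=> ipB sL LB n p sp pn; have [Bl _ _ _] := ipB.
have [|c [s [ss Lp]]] := @poly_split_lead _ n p (L p) sp.
  by rewrite (leq_trans (sL p)) ?sp.
exists c; rewrite Lp [s](orthogonal_below_eq0 ipB n) ?addr0// => q sq.
have -> : s = L p - c *: p by rewrite Lp addrC addKr.
rewrite (scalar_sub (Bl _)) (scalarZ (Bl _)) LB !pn ?mulr0 ?subrr//.
exact: leq_trans (sL q) sq.
Qed.

(** * The forms attached to the measure *)

Definition l2_form {R : realType}
    (mu : {finite_measure set (measurableTypeR R) -> \bar R})
    (p q : {poly R}) : R :=
  \int[mu]_x (p.[x] * q.[x]).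

Lemma integrable_poly {R : realType}
    {mu : {finite_measure set (measurableTypeR R) -> \bar R}} :
  finite_moments mu ->
  forall p : {poly R}, mu.-integrable setT (EFin \o horner p).
Proof.
move=> hmu p.
have -> : EFin \o horner p =
    (fun x => \sum_(i < size p) ((p`_i)%:E * (x ^+ i)%:E))%E.
  apply/funext => x /=; rewrite horner_coef -sumEFin.
  by apply: eq_bigr => i _; rewrite EFinM.
by apply: integrable_sum => // i _; apply: integrableZl => //; exact: hmu.
Qed.

Lemma l2_formE {R : realType}
    (mu : {finite_measure set (measurableTypeR R) -> \bar R}) p q :
  l2_form mu p q = \int[mu]_x (p * q).[x].
Proof. by apply: eq_Rintegral => x _; rewrite hornerM. Qed.

Lemma l2_formC {R : realType}
    (mu : {finite_measure set (measurableTypeR R) -> \bar R}) p q :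
  l2_form mu p q = l2_form mu q p.
Proof. by rewrite !l2_formE mulrC. Qed.

Lemma l2_form_ge0 {R : realType}
    (mu : {finite_measure set (measurableTypeR R) -> \bar R}) p :
  0 <= l2_form mu p p.
Proof. by apply: Rintegral_ge0 => x _; rewrite -expr2 sqr_ge0. Qed.

Lemma l2_form_linearl {R : realType}
    {mu : {finite_measure set (measurableTypeR R) -> \bar R}} :
  finite_moments mu -> forall q, scalar (l2_form mu ^~ q).
Proof.
move=> hmu q a u v; rewrite !l2_formE.
rewrite -RintegralZl//; last exact: integrable_poly.
rewrite -RintegralD//; last exact: integrable_poly.
  by apply: eq_Rintegral => x _; rewrite !hornerE/=; lra.
by apply: (integrableZl _ a (integrable_poly hmu (u * q))).
Qed.

Lemma l2_form_linearr {R : realType}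
    {mu : {finite_measure set (measurableTypeR R) -> \bar R}} :
  finite_moments mu -> forall p, scalar (l2_form mu p).
Proof.
move=> hmu p a u v; rewrite !(l2_formC mu p); exact: l2_form_linearl.
Qed.

(** The degenerate case of the Cauchy-Schwarz inequality. *)
Lemma l2_form_isotropic {R : realType}
    {mu : {finite_measure set (measurableTypeR R) -> \bar R}} :
  finite_moments mu -> forall p q,
  l2_form mu q q = 0 -> l2_form mu p q = 0.
Proof.
move=> hmu p q qq0.
have lin := l2_form_linearl hmu; have linr := l2_form_linearr hmu.
set a := l2_form mu p p; set b := l2_form mu p q.
have a0 : 0 <= a by exact: l2_form_ge0.
(* The quadratic [<t p + q, t p + q> = t ^ 2 a + 2 t b] takes negative values
   near [t = 0] unless [b = 0].  Dividing by [a + 1] instead of [a] gives such a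
   [t] without separating the case [a = 0]. *)
pose t := - b / (a + 1).
have := l2_form_ge0 mu (t *: p + q).
rewrite lin !linr qq0 addr0 (l2_formC mu q p) -/a -/b => h.
have tE : t * (a + 1) = - b by rewrite divfK// gt_eqF// ltr_wpDl.
have t0 : t ^+ 2 = 0.
  apply/eqP; rewrite eq_le sqr_ge0 andbT.
  have bE : b = - (t * (a + 1)) by rewrite tE opprK.
  rewrite bE in h; rewrite expr2; nra.
move/eqP: t0; rewrite sqrf_eq0 => /eqP t0.
by apply: oppr_inj; rewrite oppr0 -tE t0 mul0r.
Qed.

Lemma diffop_form_eigen {R : realType} {M : nat} {rho : 'I_M.+1 -> {poly R}}
    {mu : {finite_measure set (measurableTypeR R) -> \bar R}} :
  finite_moments mu -> forall lambda p q, diffop rho p = lambda *: p ->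
  diffop_form rho mu p q = lambda * l2_form mu p q.
Proof.
move=> hmu lambda p q Lp; rewrite /diffop_form Lp -/(l2_form mu _ q).
exact: (scalarZ (l2_form_linearl hmu q)).
Qed.

Lemma diffop_form_linearl {R : realType} {M : nat} (rho : 'I_M.+1 -> {poly R})
    {mu : {finite_measure set (measurableTypeR R) -> \bar R}} :
  finite_moments mu -> forall q, scalar (diffop_form rho mu ^~ q).
Proof.
move=> hmu q a u v; rewrite /diffop_form diffop_linear; exact: l2_form_linearl.
Qed.

Lemma l2_form_inner_product {R : realType} {M : nat}
    {rho : 'I_M.+1 -> {poly R}}
    {mu : {finite_measure set (measurableTypeR R) -> \bar R}} :
  finite_moments mu -> inner_product (diffop_form rho mu) ->
  inner_product (l2_form mu).
Proof.
move=> hmu [_ _ _ pos]; split.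
- exact: l2_form_linearl.
- exact: l2_form_linearr.
- exact: l2_formC.
move=> p p0; rewrite lt0r l2_form_ge0 andbT; apply/eqP => pp0.
by have := pos _ p0; rewrite /diffop_form -/(l2_form mu _ _) l2_form_isotropic// ltxx.
Qed.

Lemma diffop_form_inner_product {R : realType} {M : nat}
    {rho : 'I_M.+1 -> {poly R}}
    {mu : {finite_measure set (measurableTypeR R) -> \bar R}} :
  finite_moments mu -> orthogonal_eigenpolynomials rho mu ->
  positive_eigenvalues rho -> inner_product (diffop_form rho mu).
Proof.
move=> hmu [P [eigP [sP oP nP]]] pos.
apply: (@inner_product_of_orthogonal_basis _ _ P) => //.
- exact: diffop_form_linearl.
- by move=> p; exact: l2_form_linearr.
- move=> m n mn; have [lambda [_ Lm]] := eigP m.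
  by rewrite (diffop_form_eigen hmu _ _ _ Lm) /l2_form oP// mulr0.
move=> n; have [lambda [Pn0 Ln]] := eigP n.
rewrite (diffop_form_eigen hmu _ _ _ Ln) mulr_gt0//.
  by apply: (pos lambda (P n)); split.
by rewrite lt0r l2_form_ge0 andbT; exact: nP.
Qed.

(** The orthogonal polynomials of [mu] are at once eigenpolynomials: this gives
    the Bochner-Krall property, and through [diffop_form_eigen] it makes the same
    polynomials orthogonal for [diffop_form]. *)
Lemma orthogonal_eigenbasis {R : realType} {M : nat}
    {rho : 'I_M.+1 -> {poly R}}
    {mu : {finite_measure set (measurableTypeR R) -> \bar R}} :
  exactly_solvable rho -> finite_moments mu ->
  inner_product (diffop_form rho mu) ->
  exists P : nat -> {poly R}, forall n,
    [/\ P n \is monic, size (P n) = n.+1, orthogonal_below (l2_form mu) n (P n)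
      & exists lambda, diffop rho (P n) = lambda *: P n].
Proof.
move=> [srho _ _] hmu ip; have ip2 := l2_form_inner_product hmu ip.
have [P PP] := monic_orthogonal_exists ip2.
exists P => n; have [Pm sP oP] := PP n; split=> //.
apply: (selfadjoint_eigen ip2 (size_diffop srho) _ n) => // p q.
have [_ _ sym _] := ip.
by rewrite (l2_formC mu p); exact: (sym p q).
Qed.

Lemma orthogonal_polynomials_of_below {R : realType}
    {mu : {finite_measure set (measurableTypeR R) -> \bar R}}
    {P : nat -> {poly R}} :
  inner_product (l2_form mu) -> (forall n, size (P n) = n.+1) ->
  (forall n, orthogonal_below (l2_form mu) n (P n)) ->
  orthogonal_polynomials mu P.
Proof.
move=> [_ _ _ pos] sP oP; split=> // [m n|n].
  rewrite -/(l2_form mu _ _); case: ltngtP => // mn _; last by rewrite oP ?sP.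
  by rewrite l2_formC oP ?sP.
by rewrite -/(l2_form mu _ _) gt_eqF// pos// -size_poly_eq0 sP.
Qed.

Theorem theorem1 (R : realType) (M : nat) (rho : 'I_M.+1 -> {poly R})
    (hrho : exactly_solvable rho)
    (mu : {finite_measure set (measurableTypeR R) -> \bar R})
    (hmu : finite_moments mu) :
  (inner_product (diffop_form rho mu) <->
     (bochner_krall rho /\ orthogonal_eigenpolynomials rho mu) /\
     positive_eigenvalues rho) /\
  (inner_product (diffop_form rho mu) ->
     exists P : nat -> {poly R},
       (forall Q : nat -> {poly R},
          monic_orthogonal_polynomials mu Q <-> Q =1 P) /\
       (forall Q : nat -> {poly R},
          monic_diffop_orthogonal_sequence rho mu Q <-> Q =1 P)).
Proof.
split; first split.
- move=> ip; have ip2 := l2_form_inner_product hmu ip.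
  have [P PP] := orthogonal_eigenbasis hrho hmu ip.
  have oep : orthogonal_eigenpolynomials rho mu.
    exists P; split.
      move=> n; have [_ sP _ [lambda Lp]] := PP n.
      by exists lambda; split=> //; rewrite -size_poly_eq0 sP.
    by apply: orthogonal_polynomials_of_below => // n; have [] := PP n.
  split; first by split=> //; exists mu.
  move=> lambda p [p0 Lp]; have [_ _ _ pos] := ip; have [_ _ _ pos2] := ip2.
  by have := pos p p0; rewrite (diffop_form_eigen hmu _ _ _ Lp) pmulr_lgt0// pos2.
- by move=> [[_ oep] pos]; exact: diffop_form_inner_product.
move=> ip; have ip2 := l2_form_inner_product hmu ip.
have [P PP] := orthogonal_eigenbasis hrho hmu ip.
have below n : orthogonal_below (diffop_form rho mu) n (P n).
  move=> q sq; have [_ _ oP [lambda Lp]] := PP n.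
  by rewrite (diffop_form_eigen hmu _ _ _ Lp) oP// mulr0.
exists P; split=> Q; split.
- move=> [[sQ oQ _] Qm] n; have [Pm sP oP _] := PP n.
  apply: (monic_orthogonal_unique ip2 n) => //; rewrite ?sP ?sQ//.
  by apply: orthogonal_basis_below => //; exact: l2_form_linearr.
- move=> /funext ->; split; last by move=> n; have [] := PP n.
  by apply: orthogonal_polynomials_of_below => // n; have [] := PP n.
- move=> oQ n; have [Pm sP _ _] := PP n; have [Qm [_ sQ Qo]] := oQ n.
  by apply: (monic_orthogonal_unique ip n) => //; rewrite ?sP.
- move=> /funext -> n; have [Pm sP _ _] := PP n; split=> //; split.
  + exact: monic_neq0.
  + by rewrite sP.
  + exact: below.
Qed.
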